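(* Let $\mathbf{K}=(K,+,;,\rightarrow,0,1)$ and $\mathbf{T}=(T,+,;,\rightarrow,0,1)$ be complete residuated lattices with $T\subseteq K$, where the join, multiplication, $0$ and $1$ of $\mathbf{T}$ are the restrictions of those of $\mathbf{K}$, and suppose $a;b=b;a$ for all $a,b\in T$. Let $X$ be a set. Then $\mathbf{FREL}(\mathbf{K},\mathbf{T})=(K^{X\times X},T^{X\times X}_{\Delta},\cup,\circ,{}^*,\rightarrow,\varnothing,\Delta)$ is a graded Kleene algebra with tests (GKAT). If moreover $a;a=a$ for all $a\in T$, then $\mathbf{FREL}(\mathbf{K},\mathbf{T})$ is an idempotent graded Kleene algebra with tests (I-GKAT).
   Context: A complete residuated lattice $(W,+,;,\rightarrow,0,1)$ is a complete lattice on $W$ with binary join $+$ (arbitrary joins written $\sum$), least element $0$ and greatest element $1$, together with an associative multiplication $;$ having $1$ as two-sided unit and distributing over arbitrary joins on both sides, and a binary operation $\rightarrow$ with $a;b\leq c\Leftrightarrow b\leq a\rightarrow c$. $K^{X\times X}$ is the set of all functions $X\times X\to K$ (fuzzy relations), and $T^{X\times X}_{\Delta}$ is the set of diagonal fuzzy relations with values in $T$, i.e. functions $\sigma:X\times X\to T$ with $\sigma(x,y)=0$ whenever $x\neq y$. Operations: $(\mu\cup\nu)(x,y)=\mu(x,y)+\nu(x,y)$; $(\mu\circ\nu)(x,y)=\sum_{z\in X}\mu(x,z);\nu(z,y)$; $\mu^*(x,y)=\sum_{k\geq0}\mu^k(x,y)$ with $\mu^0=\Delta$, $\mu^{k+1}=\mu^k\circ\mu$;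 for diagonal $\sigma,\eta$: $(\sigma\rightarrow\eta)(x,y)=\sigma(x,y)\rightarrow\eta(x,y)$ (the residuum of $\mathbf{T}$) if $x=y$ and $0$ otherwise; $\varnothing(x,y)=0$; $\Delta(x,y)=1$ if $x=y$ and $0$ otherwise. A GKAT is a tuple $(K',T',+,;,{}^*,\rightarrow,0,1)$ where $K'$ is a set, $T'\subseteq K'$, $0,1\in T'$, $+$ and $;$ are binary operations on $K'$ under which $T'$ is closed, ${}^*$ is unary on $K'$, and $\rightarrow$ is a binary operation on $T'$ with values in $T'$, such that for all $p,q,r\in K'$ and $a,b,c\in T'$: $p+(q+r)=(p+q)+r$; $p+q=q+p$; $p;(q;r)=(p;q);r$; $p;1=1;p=p$; $p;(q+r)=p;q+p;r$; $(p+q);r=p;r+q;r$; $p;0=0;p=0$; $1+p;p^*=p^*$; $q+p;r\leq r\Rightarrow p^*;q\leq r$; $q+r;p\leq r\Rightarrow q;p^*\leq r$; $a;b\leq c\Leftrightarrow b\leq a\rightarrow c$; $a\leq 1$; $a;b=b;a$, where $p\leq q$ means $p+q=q$. An I-GKAT is a GKAT additionally satisfying $a;a=a$ for all $a\in T'$. *)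

(* Defs.v *)
From mathcomp Require Import all_boot.
From mathcomp Require Import boolp classical_sets.

Set Implicit Arguments.
Unset Strict Implicit.
Unset Printing Implicit Defensive.

Local Open Scope classical_set_scope.

(* Carriers are bare types and orders are Prop-valued, so that a set T of
   elements of K, seen as a type, can carry its own lattice structure, unrelated
   to any canonical structure inherited from K. *)
Record crl (W : Type) := CRL {
  crl_le : W -> W -> Prop;
  crl_sup : set W -> W;
  crl_add : W -> W -> W;
  crl_mul : W -> W -> W;
  crl_res : W -> W -> W;
  crl_zero : W;
  crl_one : W;
  crl_le_refl : forall a, crl_le a a;
  crl_le_trans : forall a b c, crl_le a b -> crl_le b c -> crl_le a c;
  crl_le_anti : forall a b, crl_le a b -> crl_le b a -> a = b;
  crl_supP : forall (S : set W) (c : W),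
    crl_le (crl_sup S) c <-> (forall s, S s -> crl_le s c);
  crl_addP : forall a b c,
    crl_le (crl_add a b) c <-> crl_le a c /\ crl_le b c;
  crl_zero_least : forall a, crl_le crl_zero a;
  crl_one_greatest : forall a, crl_le a crl_one;
  crl_mulA : forall a b c,
    crl_mul a (crl_mul b c) = crl_mul (crl_mul a b) c;
  crl_mul1l : forall a, crl_mul crl_one a = a;
  crl_mul1r : forall a, crl_mul a crl_one = a;
  crl_mul_supr : forall a (S : set W),
    crl_mul a (crl_sup S) = crl_sup [set crl_mul a s | s in S];
  crl_mul_supl : forall (S : set W) a,
    crl_mul (crl_sup S) a = crl_sup [set crl_mul s a | s in S];
  crl_resP : forall a b c,
    crl_le (crl_mul a b) c <-> crl_le b (crl_res a c)
}.

(* [T : set K] is coerced to the type of its elements, with injection [\val].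
   Only the binary join is required to be inherited: the infinite joins and the
   residuum of T may differ from those of K. *)
Record crl_restriction (K : Type) (KK : crl K) (T : set K) (TT : crl T) : Prop :=
  CrlRestriction {
  restr_add : forall a b : T,
    \val (crl_add TT a b) = crl_add KK (\val a) (\val b);
  restr_mul : forall a b : T,
    \val (crl_mul TT a b) = crl_mul KK (\val a) (\val b);
  restr_zero : \val (crl_zero TT) = crl_zero KK;
  restr_one : \val (crl_one TT) = crl_one KK
}.

Record gkat_alg := GkatAlg {
  ga_sort :> Type;
  ga_test : set ga_sort;
  ga_add : ga_sort -> ga_sort -> ga_sort;
  ga_mul : ga_sort -> ga_sort -> ga_sort;
  ga_star : ga_sort -> ga_sort;
  ga_imp : ga_test -> ga_test -> ga_test;
  ga_zero : ga_sort;
  ga_one : ga_sort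
}.

Definition ga_le (A : gkat_alg) (p q : A) : Prop := ga_add p q = q.

Record is_gkat (A : gkat_alg) : Prop := IsGkat {
  gkat_test0 : ga_test (ga_zero A);
  gkat_test1 : ga_test (ga_one A);
  gkat_testD : forall a b : A,
    ga_test a -> ga_test b -> ga_test (ga_add a b);
  gkat_testM : forall a b : A,
    ga_test a -> ga_test b -> ga_test (ga_mul a b);
  gkat_addA : forall p q r : A,
    ga_add p (ga_add q r) = ga_add (ga_add p q) r;
  gkat_addC : forall p q : A, ga_add p q = ga_add q p;
  gkat_mulA : forall p q r : A,
    ga_mul p (ga_mul q r) = ga_mul (ga_mul p q) r;
  gkat_mulr1 : forall p : A, ga_mul p (ga_one A) = p;
  gkat_mul1r : forall p : A, ga_mul (ga_one A) p = p;
  gkat_mulDr : forall p q r : A,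
    ga_mul p (ga_add q r) = ga_add (ga_mul p q) (ga_mul p r);
  gkat_mulDl : forall p q r : A,
    ga_mul (ga_add p q) r = ga_add (ga_mul p r) (ga_mul q r);
  gkat_mulr0 : forall p : A, ga_mul p (ga_zero A) = ga_zero A;
  gkat_mul0r : forall p : A, ga_mul (ga_zero A) p = ga_zero A;
  gkat_star_unfold : forall p : A,
    ga_add (ga_one A) (ga_mul p (ga_star p)) = ga_star p;
  gkat_star_indl : forall p q r : A,
    ga_le (ga_add q (ga_mul p r)) r -> ga_le (ga_mul (ga_star p) q) r;
  gkat_star_indr : forall p q r : A,
    ga_le (ga_add q (ga_mul r p)) r -> ga_le (ga_mul q (ga_star p)) r;
  gkat_impP : forall a b c : @ga_test A,
    ga_le (ga_mul (\val a) (\val b)) (\val c) <->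
    ga_le (\val b) (\val (ga_imp a c));
  gkat_test_le1 : forall a : A, ga_test a -> ga_le a (ga_one A);
  gkat_test_mulC : forall a b : A,
    ga_test a -> ga_test b -> ga_mul a b = ga_mul b a
}.

Record is_igkat (A : gkat_alg) : Prop := IsIgkat {
  igkat_gkat : is_gkat A;
  igkat_idem : forall a : A, ga_test a -> ga_mul a a = a
}.

Section FuzzyRelations.
Variables (K : Type) (KK : crl K) (X : Type).

Definition frel : Type := X -> X -> K.

Definition frel_cup (mu nu : frel) : frel :=
  fun x y => crl_add KK (mu x y) (nu x y).

Definition frel_comp (mu nu : frel) : frel :=
  fun x y => crl_sup KK [set crl_mul KK (mu x z) (nu z y) | z in [set: X]].

Definition frel_empty : frel := fun _ _ => crl_zero KK.

Definition frel_delta : frel :=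
  fun x y => if `[< x = y >] then crl_one KK else crl_zero KK.

Fixpoint frel_pow (mu : frel) (k : nat) : frel :=
  if k is k'.+1 then frel_comp (frel_pow mu k') mu else frel_delta.

Definition frel_star (mu : frel) : frel :=
  fun x y => crl_sup KK [set frel_pow mu k x y | k in [set: nat]].

Definition frel_diag (T : set K) : set frel :=
  [set sigma | (forall x y, T (sigma x y)) /\
               (forall x y, x <> y -> sigma x y = crl_zero KK)].

Variables (T : set K) (TT : crl T).
Hypothesis KT : crl_restriction KK TT.

Lemma frel_diag_test (sigma : frel_diag T) x y : \val sigma x y \in T.
Proof. by case: sigma => s /= /set_mem[sT _]; apply/mem_set/sT. Qed.

Definition frel_val (sigma : frel_diag T) (x y : X) : T :=
  exist _ (\val sigma x y) (frel_diag_test sigma x y).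

Definition frel_imp_fun (sigma eta : frel_diag T) : frel :=
  fun x y => if `[< x = y >]
             then \val (crl_res TT (frel_val sigma x y) (frel_val eta x y))
             else crl_zero KK.

Lemma frel_imp_diag (sigma eta : frel_diag T) :
  frel_imp_fun sigma eta \in frel_diag T.
Proof.
apply/mem_set; split=> x y; rewrite /frel_imp_fun; last first.
  by move=> xy; case: asboolP.
by case: asboolP => _; last rewrite -(restr_zero KT); apply/set_mem/valP.
Qed.

Definition frel_imp (sigma eta : frel_diag T) : frel_diag T :=
  exist _ (frel_imp_fun sigma eta) (frel_imp_diag sigma eta).

Definition FREL : gkat_alg :=
  @GkatAlg frel (frel_diag T) frel_cup frel_comp frel_star frel_imp
           frel_empty frel_delta.

End FuzzyRelations.

Arguments FREL {K KK} X {T TT} KT.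

(* Main.v *)
Require Import Defs.
From mathcomp Require Import all_boot.
From mathcomp Require Import boolp classical_sets.

(** The algebraic laws follow by antisymmetry: multiplication preserves
    arbitrary joins, so both sides of each law have the same upper bounds.
    Since [mu^*] is the join of the powers of [mu], the two star inductions
    reduce to [mu^k o r <= r] when [mu o r <= r], and to [q o mu^k <= r] when
    [q + r o mu <= r], both by induction on [k]. Composing with a diagonal
    relation on either side is a pointwise multiplication by its diagonal
    entries, which reduces all the laws on tests to laws in [T]; the order of
    [T] is inherited from [K], because the binary join is. *)

Set Implicit Arguments.
Unset Strict Implicit.
Unset Printing Implicit Defensive.

Local Open Scope classical_set_scope.

(** * Complete residuated lattices: joins, distributivity and monotonicity *)

Section CompleteResiduatedLattice.
Variables (K : Type) (KK : crl K).
Local Notation le := (crl_le KK).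
Local Notation add := (crl_add KK).
Local Notation mul := (crl_mul KK).
Local Notation sup := (crl_sup KK).
Local Notation zero := (crl_zero KK).

(** Turns an equation between joins into an equivalence of upper bounds, where [crl_supP] and
    [crl_addP] serve as rewriting rules. *)
Lemma crl_eq_ub a b : (forall c, le a c <-> le b c) -> a = b.
Proof.
by move=> ab; apply: (@crl_le_anti _ KK); apply/ab; apply: crl_le_refl.
Qed.

Lemma crl_le_addl a b : le a (add a b).
Proof. by have /crl_addP[] := crl_le_refl KK (add a b). Qed.

Lemma crl_le_addr a b : le b (add a b).
Proof. by have /crl_addP[] := crl_le_refl KK (add a b). Qed.

Lemma crl_addE a b : add a b = b <-> le a b.
Proof.
split=> [<-|ab]; first exact: crl_le_addl.
apply: (@crl_le_anti _ KK); last exact: crl_le_addr.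
by apply/crl_addP; split=> //; apply: crl_le_refl.
Qed.

Lemma crl_sup_ub (S : set K) s : S s -> le s (sup S).
Proof. by move: s; apply/crl_supP/crl_le_refl. Qed.

(** Lets the distributivity axioms, stated for [sup], apply to binary joins. *)
Lemma crl_add_sup2 a b : add a b = sup [set a; b].
Proof.
apply: crl_eq_ub => c; rewrite crl_addP crl_supP.
split=> [[ac bc] s [->|->] //|h].
by split; apply: h; [left|right].
Qed.

Lemma crl_mul_supr_le a (S : set K) c :
  le (mul a (sup S)) c <-> (forall s, S s -> le (mul a s) c).
Proof.
rewrite crl_mul_supr crl_supP; split=> [h s Ss|h _ [s Ss <-]]; last exact: h.
by apply: h; exists s.
Qed.

Lemma crl_mul_supl_le (S : set K) a c :
  le (mul (sup S) a) c <-> (forall s, S s -> le (mul s a) c).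
Proof.
rewrite crl_mul_supl crl_supP; split=> [h s Ss|h _ [s Ss <-]]; last exact: h.
by apply: h; exists s.
Qed.

Lemma crl_mul_addr_le a b c d :
  le (mul a (add b c)) d <-> le (mul a b) d /\ le (mul a c) d.
Proof.
rewrite crl_add_sup2 crl_mul_supr_le.
by split=> [h|[hb hc] s [->|->] //]; split; apply: h; [left|right].
Qed.

Lemma crl_mul_addl_le a b c d :
  le (mul (add a b) c) d <-> le (mul a c) d /\ le (mul b c) d.
Proof.
rewrite crl_add_sup2 crl_mul_supl_le.
by split=> [h|[hb hc] s [->|->] //]; split; apply: h; [left|right].
Qed.

(** Writing [b] as [add a b] and [d] as [add c d], distributivity makes [mul a c] lie below
    [mul b c], which lies below [mul b d]. *)
Lemma crl_mul_mono a b c d : le a b -> le c d -> le (mul a c) (mul b d).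
Proof.
move=> /crl_addE ab /crl_addE cd.
have /crl_mul_addr_le[h _] : le (mul b (add c d)) (mul b d).
  by rewrite cd; apply: crl_le_refl.
suff /crl_mul_addl_le[] : le (mul (add a b) c) (mul b d) by [].
by rewrite ab.
Qed.

Lemma crl_le_zero a : le a zero -> a = zero.
Proof. by move=> a0; apply: (crl_le_anti a0); apply: crl_zero_least. Qed.

Lemma crl_mulr0 a : mul a zero = zero.
Proof. by apply/crl_le_zero/crl_resP/crl_zero_least. Qed.

(** The residuum governs the right factor only, so here zero is taken as the empty join, over which
    multiplication distributes. *)
Lemma crl_mul0l a : mul zero a = zero.
Proof.
have <- : sup set0 = zero by apply/crl_le_zero/crl_supP.
apply: crl_eq_ub => c; rewrite crl_mul_supl_le crl_supP.
by split=> _ s [].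
Qed.

End CompleteResiduatedLattice.

(** * Fuzzy relations: composition, powers and the star laws *)

Section FuzzyRelationAlgebra.
Variables (K : Type) (KK : crl K) (X : Type).
Local Notation le := (crl_le KK).
Local Notation mul := (crl_mul KK).
Local Notation frel := (Defs.frel K X).
Local Notation cup := (@frel_cup K KK X).
Local Notation comp := (@frel_comp K KK X).
Local Notation pow := (@frel_pow K KK X).
Local Notation star := (@frel_star K KK X).
Local Notation delta := (@frel_delta K KK X).
Local Notation empty := (@frel_empty K KK X).
Implicit Types p q r s : frel.

Definition frel_le p q := forall x y, le (p x y) (q x y).

Lemma frel_ext p q : (forall x y, p x y = q x y) -> p = q.
Proof. by move=> pq; apply/funext => x; apply/funext => y. Qed.

Lemma frel_le_refl p : frel_le p p.
Proof. by move=> x y; apply: crl_le_refl. Qed.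

Lemma frel_le_trans p q r : frel_le p q -> frel_le q r -> frel_le p r.
Proof. by move=> pq qr x y; apply: crl_le_trans (pq x y) (qr x y). Qed.

Lemma frel_le_anti p q : frel_le p q -> frel_le q p -> p = q.
Proof.
by move=> pq qp; apply: frel_ext => x y; apply: crl_le_anti (pq x y) (qp x y).
Qed.

Lemma frel_cupE p q : cup p q = q <-> frel_le p q.
Proof.
split=> [pq x y|pq].
  by apply/crl_addE; rewrite -[in RHS]pq.
by apply: frel_ext => x y; apply/crl_addE.
Qed.

Lemma frel_cup_le p q r : frel_le (cup p q) r <-> frel_le p r /\ frel_le q r.
Proof.
split=> [h|[pr qr] x y]; last by apply/crl_addP.
by split=> x y; have /crl_addP[] := h x y.
Qed.

Lemma frel_cup_le_at p q x y c :
  le (cup p q x y) c <-> le (p x y) c /\ le (q x y) c.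
Proof. exact: crl_addP. Qed.

Lemma frel_comp_le_at p q x y c :
  le (comp p q x y) c <-> (forall z, le (mul (p x z) (q z y)) c).
Proof.
rewrite crl_supP; split=> [h z|h _ [z _ <-] //].
by apply: h; exists z.
Qed.

(** Either side is below [c] exactly when every triple product along a path from [x] to [y] is. *)
Lemma frel_compA p q r : comp p (comp q r) = comp (comp p q) r.
Proof.
apply: frel_ext => x y; apply: (crl_eq_ub (KK := KK)) => c; rewrite !frel_comp_le_at.
split=> h z.
  apply/crl_mul_supl_le => _ [w _ <-]; rewrite -crl_mulA.
  by move: (h w) => /crl_mul_supr_le; apply; exists z.
apply/crl_mul_supr_le => _ [w _ <-]; rewrite crl_mulA.
by move: (h w) => /crl_mul_supl_le; apply; exists z.
Qed.

Lemma frel_comp_mono p q r s :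
  frel_le p q -> frel_le r s -> frel_le (comp p r) (comp q s).
Proof.
move=> pq rs x y; apply/frel_comp_le_at => z.
apply: crl_le_trans (crl_mul_mono (pq x z) (rs z y)) _.
by apply: crl_sup_ub; exists z.
Qed.

Lemma frel_comp_cupr p q r : comp p (cup q r) = cup (comp p q) (comp p r).
Proof.
apply: frel_ext => x y; apply: (crl_eq_ub (KK := KK)) => c.
rewrite frel_cup_le_at !frel_comp_le_at.
split=> [h|[hq hr] z]; last by apply/crl_mul_addr_le.
by split=> z; have /crl_mul_addr_le[] := h z.
Qed.

Lemma frel_comp_cupl p q r : comp (cup p q) r = cup (comp p r) (comp q r).
Proof.
apply: frel_ext => x y; apply: (crl_eq_ub (KK := KK)) => c.
rewrite frel_cup_le_at !frel_comp_le_at.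
split=> [h|[hq hr] z]; last by apply/crl_mul_addl_le.
by split=> z; have /crl_mul_addl_le[] := h z.
Qed.

(** In the join over [z], every term with [z] different from [x] is zero. *)
Lemma frel_comp_diagl p q x y :
  (forall u v, u <> v -> p u v = crl_zero KK) ->
  comp p q x y = mul (p x x) (q x y).
Proof.
move=> pd; apply: (crl_eq_ub (KK := KK)) => c; rewrite frel_comp_le_at.
split=> [h|h z]; first exact: h.
have [<-//|/pd ->] := pselect (x = z).
by rewrite crl_mul0l; apply: crl_zero_least.
Qed.

Lemma frel_comp_diagr p q x y :
  (forall u v, u <> v -> q u v = crl_zero KK) ->
  comp p q x y = mul (p x y) (q y y).
Proof.
move=> qd; apply: (crl_eq_ub (KK := KK)) => c; rewrite frel_comp_le_at.
split=> [h|h z]; first exact: h.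
have [->//|/qd ->] := pselect (z = y).
by rewrite crl_mulr0; apply: crl_zero_least.
Qed.

Lemma frel_deltaxx x : delta x x = crl_one KK.
Proof. by rewrite /frel_delta; case: asboolP. Qed.

Lemma frel_delta_neq x y : x <> y -> delta x y = crl_zero KK.
Proof. by rewrite /frel_delta; case: asboolP. Qed.

Lemma frel_comp1l p : comp delta p = p.
Proof.
apply: frel_ext => x y; rewrite (frel_comp_diagl _ _ _ frel_delta_neq).
by rewrite frel_deltaxx crl_mul1l.
Qed.

Lemma frel_comp1r p : comp p delta = p.
Proof.
apply: frel_ext => x y; rewrite (frel_comp_diagr _ _ _ frel_delta_neq).
by rewrite frel_deltaxx crl_mul1r.
Qed.

Lemma frel_comp0l p : comp empty p = empty.
Proof. by apply: frel_ext => x y; rewrite frel_comp_diagl // crl_mul0l. Qed.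

Lemma frel_comp0r p : comp p empty = empty.
Proof. by apply: frel_ext => x y; rewrite frel_comp_diagr // crl_mulr0. Qed.

(** Powers grow on the right by definition; unfolding the star needs them to grow on the left. *)
Lemma frel_powSr p k : pow p k.+1 = comp p (pow p k).
Proof.
elim: k => [|k IH]; first by rewrite /= frel_comp1l frel_comp1r.
(* After reassociation the inner factor [comp (pow p k) p] is [pow p k.+1] by definition. *)
by rewrite -[LHS]/(comp (pow p k.+1) p) {1}IH -frel_compA.
Qed.

Lemma frel_pow_le_star p k : frel_le (pow p k) (star p).
Proof. by move=> x y; apply: crl_sup_ub; exists k. Qed.

Lemma frel_star_le p q : (forall k, frel_le (pow p k) q) -> frel_le (star p) q.
Proof. by move=> h x y; apply/crl_supP => _ [k _ <-]; apply: h. Qed.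

Lemma frel_comp_starl_le p q r :
  (forall k, frel_le (comp (pow p k) q) r) -> frel_le (comp (star p) q) r.
Proof.
move=> h x y; apply/frel_comp_le_at => z.
apply/crl_mul_supl_le => _ [k _ <-].
(* With [k] fixed, quantifying over [z] again reassembles the bound on the whole composite with
   [pow p k]. *)
by move: z; apply/frel_comp_le_at/h.
Qed.

Lemma frel_comp_starr_le p q r :
  (forall k, frel_le (comp q (pow p k)) r) -> frel_le (comp q (star p)) r.
Proof.
move=> h x y; apply/frel_comp_le_at => z.
apply/crl_mul_supr_le => _ [k _ <-].
by move: z; apply/frel_comp_le_at/h.
Qed.

(** Each power is either [delta] or [p] composed with the previous power, so both sides are joins of
    the same relations. *)
Lemma frel_star_unfold p : cup delta (comp p (star p)) = star p.
Proof.
apply: frel_le_anti.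
  apply/frel_cup_le; split; first exact: (frel_pow_le_star p 0).
  by apply: frel_comp_starr_le => k; rewrite -frel_powSr; apply: frel_pow_le_star.
apply: frel_star_le => -[|k].
  by move=> x y; apply: crl_le_addl.
rewrite frel_powSr.
have pk : frel_le (comp p (pow p k)) (comp p (star p)).
  by apply: frel_comp_mono; [apply: frel_le_refl|apply: frel_pow_le_star].
by apply: frel_le_trans pk _ => x y; apply: crl_le_addr.
Qed.

Lemma frel_star_indl p q r :
  frel_le (cup q (comp p r)) r -> frel_le (comp (star p) q) r.
Proof.
move=> /frel_cup_le[qr prr]; apply: frel_comp_starl_le => k.
(* With [r] in place of [q] the induction closes: the last factor [p] of [pow p k.+1] is absorbed by
   [r]. *)
apply: (@frel_le_trans _ (comp (pow p k) r)).
  by apply: frel_comp_mono => //; apply: frel_le_refl.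
elim: k => [|k IH]; first by rewrite frel_comp1l; apply: frel_le_refl.
rewrite /= -frel_compA; apply: frel_le_trans IH.
by apply: frel_comp_mono => //; apply: frel_le_refl.
Qed.

Lemma frel_star_indr p q r :
  frel_le (cup q (comp r p)) r -> frel_le (comp q (star p)) r.
Proof.
move=> /frel_cup_le[qr rpr]; apply: frel_comp_starr_le.
elim=> [|k IH]; first by rewrite frel_comp1r.
(* The new factor [p] is already outermost on the right, so the induction hypothesis applies to [q]
   directly. *)
rewrite /= frel_compA; apply: frel_le_trans rpr.
by apply: frel_comp_mono => //; apply: frel_le_refl.
Qed.

End FuzzyRelationAlgebra.

(** * Tests: diagonal relations with values in [T] *)

Section Tests.
Variables (K : Type) (KK : crl K) (T : set K) (TT : crl T).
Hypothesis KT : crl_restriction KK TT.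

Lemma restr_le (a b : T) : crl_le TT a b <-> crl_le KK (\val a) (\val b).
Proof.
rewrite -!crl_addE -(restr_add KT).
by split=> [->//|ab]; apply: val_inj.
Qed.

Lemma restr_mem0 : T (crl_zero KK).
Proof. by rewrite -(restr_zero KT); apply/set_mem/valP. Qed.

Lemma restr_mem1 : T (crl_one KK).
Proof. by rewrite -(restr_one KT); apply/set_mem/valP. Qed.

Lemma restr_memD a b : T a -> T b -> T (crl_add KK a b).
Proof.
move=> Ta Tb.
rewrite -(restr_add KT (exist _ a (mem_set Ta)) (exist _ b (mem_set Tb))).
exact/set_mem/valP.
Qed.

Lemma restr_memM a b : T a -> T b -> T (crl_mul KK a b).
Proof.
move=> Ta Tb.
rewrite -(restr_mul KT (exist _ a (mem_set Ta)) (exist _ b (mem_set Tb))).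
exact/set_mem/valP.
Qed.

Variable X : Type.
Local Notation diag := (@frel_diag K KK X T).

Lemma frel_diag0 : diag (@frel_empty K KK X).
Proof. by split=> // x y; apply: restr_mem0. Qed.

Lemma frel_diag1 : diag (@frel_delta K KK X).
Proof.
split=> x y; last exact: frel_delta_neq.
rewrite /frel_delta; case: asboolP => _; [exact: restr_mem1|exact: restr_mem0].
Qed.

Lemma frel_diagD p q : diag p -> diag q -> diag (frel_cup KK p q).
Proof.
move=> [Tp p0] [Tq q0]; split=> x y; first exact: restr_memD.
by move=> xy; rewrite /frel_cup p0 // q0 //; apply/crl_addE/crl_le_refl.
Qed.

Lemma frel_diagM p q : diag p -> diag q -> diag (frel_comp KK p q).
Proof.
move=> [Tp p0] [Tq q0]; split=> x y; rewrite (frel_comp_diagl _ _ _ p0).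
  exact: restr_memM.
by move=> xy; rewrite (q0 x y) // crl_mulr0.
Qed.

Lemma frel_diag_le1 p : diag p -> frel_le KK p (@frel_delta K KK X).
Proof.
move=> [_ p0] x y; have [<-|xy] := pselect (x = y).
  by rewrite frel_deltaxx; apply: crl_one_greatest.
by rewrite p0 //; apply: crl_zero_least.
Qed.

Lemma frel_diag_compC p q :
  (forall a b, T a -> T b -> crl_mul KK a b = crl_mul KK b a) ->
  diag p -> diag q -> frel_comp KK p q = frel_comp KK q p.
Proof.
move=> mulC [Tp p0] [Tq q0]; apply: frel_ext => x y.
rewrite (frel_comp_diagl _ _ _ p0) (frel_comp_diagl _ _ _ q0).
have [<-|xy] := pselect (x = y); first exact: mulC.
by rewrite (p0 x y) // (q0 x y) // !crl_mulr0.
Qed.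

Lemma frel_diag_comp_idem p :
  (forall a, T a -> crl_mul KK a a = a) -> diag p -> frel_comp KK p p = p.
Proof.
move=> idem [Tp p0]; apply: frel_ext => x y.
rewrite (frel_comp_diagl _ _ _ p0).
have [<-|xy] := pselect (x = y); first exact: idem.
by rewrite (p0 x y) // crl_mulr0.
Qed.

(** Off the diagonal [b] and the composite vanish, so both inequalities hold; on it the claim is
    residuation in [T]. *)
Lemma frel_impP (a b c : diag) :
  frel_le KK (frel_comp KK (\val a) (\val b)) (\val c) <->
  frel_le KK (\val b) (\val (frel_imp KT a c)).
Proof.
have [_ a0] : diag (\val a) by apply/set_mem/valP.
have [_ b0] : diag (\val b) by apply/set_mem/valP.
have imp_at x :
    crl_le KK (crl_mul KK (\val a x x) (\val b x x)) (\val c x x) <->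
    crl_le KK (\val b x x) (\val (frel_imp KT a c) x x).
  rewrite -[\val (frel_imp KT a c) x x]/(frel_imp_fun TT a c x x) /frel_imp_fun.
  case: asboolP => // _.
  (* Viewing the entry of [b] as an element of [T] moves the inequality into the order of [T], where
     the residuum is adjoint, and then back to [K]. *)
  rewrite -[\val b x x]/(\val (frel_val b x x)) -restr_le -crl_resP restr_le.
  by rewrite (restr_mul KT).
split=> h x y; have [<-|xy] := pselect (x = y).
- by apply/imp_at; have := h x x; rewrite (frel_comp_diagl _ _ _ a0).
- by rewrite b0 //; apply: crl_zero_least.
- by rewrite (frel_comp_diagl _ _ _ a0); apply/imp_at.
- rewrite (frel_comp_diagl _ _ _ a0) (b0 x y) // crl_mulr0.
  exact: crl_zero_least.
Qed.

End Tests.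

Theorem theorem4 (K : Type) (KK : crl K) (T : set K) (TT : crl T)
    (KT : crl_restriction KK TT)
    (mulC : forall a b : K, T a -> T b -> crl_mul KK a b = crl_mul KK b a)
    (X : Type) :
  is_gkat (FREL X KT) /\
  ((forall a : K, T a -> crl_mul KK a a = a) -> is_igkat (FREL X KT)).
Proof.
have gkat : is_gkat (FREL X KT).
  split.
  - exact: (frel_diag0 KT).
  - exact: (frel_diag1 KT).
  - exact: (frel_diagD KT).
  - exact: (frel_diagM KT).
  (* On upper bounds, associativity and commutativity of the join become those of conjunction. *)
  - move=> p q r; apply: frel_ext => x y; apply: (crl_eq_ub (KK := KK)) => c.
    by rewrite /= /frel_cup !crl_addP; tauto.
  - move=> p q; apply: frel_ext => x y; apply: (crl_eq_ub (KK := KK)) => c.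
    by rewrite /= /frel_cup !crl_addP; tauto.
  - exact: frel_compA.
  - exact: frel_comp1r.
  - exact: frel_comp1l.
  - exact: frel_comp_cupr.
  - exact: frel_comp_cupl.
  - exact: frel_comp0r.
  - exact: frel_comp0l.
  - exact: frel_star_unfold.
  (* The order [ga_le] is an equation on joins; [frel_cupE] translates it to the pointwise order. *)
  - by move=> p q r /frel_cupE h; apply/frel_cupE/frel_star_indl.
  - by move=> p q r /frel_cupE h; apply/frel_cupE/frel_star_indr.
  - move=> a b c; split=> /frel_cupE h; apply/frel_cupE.
      exact/(frel_impP KT).
    exact/(frel_impP KT a b c).
  - by move=> a /frel_diag_le1 h; apply/frel_cupE.
  - by move=> a b; apply: frel_diag_compC.
split=> // idem; split=> // a; exact: frel_diag_comp_idem.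
Qed.
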